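(* $\mathcal{L}_p(\mathrm{J}(\mathbb{R}^n))=\left(2^{\mathfrak{c}}\right)^+$ for every integer $n\geq 1$. In particular, the families $\mathrm{J}(\mathbb{R}^n)$, $\mathrm{PES}(\mathbb{R}^n)$, $\mathrm{SES}(\mathbb{R}^n)$, and $\mathrm{ES}(\mathbb{R}^n)$ are $2^{\mathfrak{c}}$-spaceable with respect to the topology of pointwise convergence.
   Context: $\mathfrak{c}=|\mathbb{R}|$ and $\kappa^+$ is the cardinal successor of $\kappa$. Work in the real vector space $\mathbb{R}^{\mathbb{R}^n}$ of all functions from $\mathbb{R}^n$ to $\mathbb{R}$, with $\tau_p$ the topology of pointwise convergence. $M\subset\mathbb{R}^{\mathbb{R}^n}$ is $\mu$-spaceable with respect to $\tau_p$ if $M\cup\{0\}$ contains a $\tau_p$-closed vector subspace of dimension $\mu$; $\mathcal{L}_p(M)=\min\{\kappa\colon M\cup\{0\}\text{ contains no } \tau_p\text{-closed vector subspace of dimension }\kappa\}$. Classes of functions $f\colon\mathbb{R}^n\to\mathbb{R}$ (a function is identified with its graph; a perfect set is a nonempty closed set without isolated points): - $\mathrm{ES}(\mathbb{R}^n)$ (everywhere surjective): $f[G]=\mathbb{R}$ for every nonempty open $G\subset\mathbb{R}^n$. - $\mathrm{SES}(\mathbb{R}^n)$ (strongly everywhere surjective): $f^{-1}(y)\cap G$ has cardinality $\mathfrak{c}$ for every $y\in\mathbb{R}$ and every nonempty open $G\subset\mathbb{R}^n$. - $\mathrm{PES}(\mathbb{R}^n)$ (perfectly everywhere surjective): $f[P]=\mathbb{R}$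 for every perfect set $P\subset\mathbb{R}^n$. - $\mathrm{J}(\mathbb{R}^n)$ (Jones functions): $f\cap F\neq\varnothing$ for every closed set $F\subset\mathbb{R}^n\times\mathbb{R}$ whose projection on $\mathbb{R}^n$ is uncountable.
   Formalization: L_p(M) is taken as the least κ such that M∪{0} contains no τ_p-closed subspace of dimension κ or larger; with ''of dimension κ'' alone the claim is false, since no τ_p-closed subspace has dimension ℵ₀, so the minimum never exceeds ℵ₀. *)

(* Defs.v *)
From HB Require Import structures.
From mathcomp Require Import all_boot all_order all_algebra.
From mathcomp Require Import all_classical all_reals all_analysis.

Set Implicit Arguments.
Unset Strict Implicit.
Unset Printing Implicit Defensive.

Import Order.TTheory GRing.Theory Num.Theory.
Import numFieldNormedType.Exports.

Local Open Scope classical_set_scope.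
Local Open Scope card_scope.
Local Open Scope ring_scope.

(* A cardinal is represented by a type, up to equipotence: [K : Type] stands
   for |K|.  In particular |R| is the continuum and [set R], the type of all
   subsets of R, stands for 2^|R|. *)
Definition card_leT (K L : Type) : Prop := [set: K] #<= [set: L].

Definition card_ltT (K L : Type) : Prop := card_leT K L /\ ~ card_leT L K.

(* [K] is (up to equipotence) the least cardinal with property [P]. *)
Definition is_min_card (P : Type -> Prop) (K : Type) : Prop :=
  P K /\ forall L : Type, P L -> card_leT K L.

Definition is_succ_card (K L : Type) : Prop := is_min_card (card_ltT K) L.

Section HamelDimension.
Context {F : fieldType} {V : lmodType F}.

Definition lin_span (B : set V) : set V :=
  [set v | exists (s : seq V) (c : V -> F),
     [set` s] `<=` B /\ v = \sum_(u <- s) c u *: u].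

Definition lin_indep (B : set V) : Prop :=
  forall (s : seq V) (c : V -> F), uniq s -> [set` s] `<=` B ->
    \sum_(u <- s) c u *: u = 0 -> {in s, forall u, c u = 0}.

Definition hamel_basis (W B : set V) : Prop :=
  lin_indep B /\ lin_span B = W.

Definition has_dim (W : set V) (K : Type) : Prop :=
  exists2 B : set V, hamel_basis W B & B #= [set: K].

End HamelDimension.

Section FunctionSpace.
Variables (R : realType) (n : nat).
Implicit Types (M : set ('rV[R]_n -> R)) (f : 'rV[R]_n -> R).

(* [M] is |K|-spaceable for the topology of pointwise convergence. *)
Definition ptws_spaceable M (K : Type) : Prop :=
  exists W : set ('rV[R]_n -> R),
    [/\ GRing.submod_closed [in W],
        closed (W : set {ptws 'rV[R]_n -> R}),
        has_dim W K
      & W `<=` M `|` [set 0]].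

(* [K] is the cardinal L_p(M), the least cardinal such that M `|` [set 0]
   contains no pointwise closed subspace of that dimension or larger.
   "Or larger" is redundant for the analogous cardinal without topology, since
   a vector space has subspaces of every smaller dimension, but not for closed
   subspaces: an infinite-dimensional pointwise closed subspace is the full
   algebraic dual of an infinite-dimensional space, hence has dimension at
   least the continuum.  Without "or larger" the minimum would never exceed
   aleph_0, whatever M is. *)
Definition is_ptws_Lp M (K : Type) : Prop :=
  is_min_card
    (fun L => forall D : Type, card_leT L D -> ~ ptws_spaceable M D) K.

Definition ES : set ('rV[R]_n -> R) :=
  [set f | forall G : set 'rV[R]_n, open G -> G !=set0 -> f @` G = setT].

Definition SES : set ('rV[R]_n -> R) :=
  [set f | forall (y : R) (G : set 'rV[R]_n), open G -> G !=set0 ->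
     (f @^-1` [set y] `&` G) #= [set: R]].

(* The library's [perfect_set] allows the empty set. *)
Definition PES : set ('rV[R]_n -> R) :=
  [set f | forall P : set 'rV[R]_n, perfect_set P -> P !=set0 ->
     f @` P = setT].

Definition fun_graph f : set ('rV[R]_n * R) := [set p | p.2 = f p.1].

Definition Jones : set ('rV[R]_n -> R) :=
  [set f | forall F : set ('rV[R]_n * R), closed F ->
     ~ countable (fst @` F) -> fun_graph f `&` F !=set0].

End FunctionSpace.

(* Main.v *)
Require Import Defs.
From HB Require Import structures.
From mathcomp Require Import all_boot all_order all_algebra.
From mathcomp Require Import all_classical all_reals all_analysis.
From mathcomp Require Import lra.

Set Implicit Arguments.
Unset Strict Implicit.
Unset Printing Implicit Defensive.

Import Order.TTheory GRing.Theory Num.Theory.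
Import numFieldNormedType.Exports Defs.

Local Open Scope classical_set_scope.
Local Open Scope card_scope.
Local Open Scope ring_scope.

(* List as j all tuples (F, q, t, u) of a closed set F with uncountable
   projection, an index q in a set I of size at most c, and reals t and u.
   There are at most c tuples, while each projection has at least c points
   (by a Cantor scheme of compact sets), so a transfinite recursion picks
   pairwise distinct points x_j in the projection of F, together with y_j
   such that (x_j, y_j) is in F. Choose functions s and i on the points with
   s(x_j) = t y_j and i(x_j) = q. Then for a : I -> R with a(q) <> 0, the
   function x |-> s(x) a(i(x)) meets F at x_j for every j = (F, q, 1 / a(q),
   u). These functions form a pointwise closed space isomorphic to R^I,
   which contains 2^c linearly independent elements. As there are only 2^c
   functions R^n -> R, the value of L_p follows. *)

(** * Cardinal comparison through injections *)

Lemma card_setTP (K U : Type) (B : set U) :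
  [set: K] #<= B <-> exists2 f : K -> U, injective f & forall x, B (f x).
Proof.
split=> [/card_leP[f]|[f finj fB]].
  exists (fun k => val (f (to_setT k))) => [x y /val_inj /'inj_f|x].
    by rewrite !inE => /(_ I I) /(congr1 val).
  exact: set_valP.
have /Pfun[g gE] : set_fun [set: K] B f by [].
have /funPinj[h _] : {in [set: K] &, injective g} by rewrite -gE => x y _ _ /finj.
exact: inj_card_le h.
Qed.

Lemma card_leTP (K L : Type) :
  card_leT K L <-> exists f : K -> L, injective f.
Proof.
rewrite /card_leT card_setTP; split=> [[f finj _]|[f finj]]; by exists f.
Qed.

Lemma card_leT_trans (K L M : Type) :
  card_leT K L -> card_leT L M -> card_leT K M.
Proof. exact: card_le_trans. Qed.

Lemma card_leT_surj (K L : Type) (f : K -> L) :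
  (forall y, exists x, f x = y) -> card_leT L K.
Proof.
move=> fsurj; apply/card_leTP; exists (fun y => projT1 (cid (fsurj y))) => y z e.
by rewrite -(projT2 (cid (fsurj y))) e (projT2 (cid (fsurj z))).
Qed.

Lemma card_leT_fun (I K L : Type) : card_leT K L -> card_leT (I -> K) (I -> L).
Proof.
move=> /card_leTP[f finj]; apply/card_leTP; exists (fun g i => f (g i)) => g h.
by move=> e; apply/funext => i; apply: finj; exact: (congr1 (@^~ i) e).
Qed.

Lemma card_leT_prod (K L K' L' : Type) :
  card_leT K K' -> card_leT L L' -> card_leT (K * L) (K' * L').
Proof.
move=> /card_leTP[f finj] /card_leTP[g ginj]; apply/card_leTP.
by exists (fun p => (f p.1, g p.2)) => -[a b] [c d] /= [/finj-> /ginj->].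
Qed.

Lemma card_leT_set (K L : Type) : card_leT K L -> card_leT (set K) (set L).
Proof.
move=> /card_leTP[f finj]; apply/card_leTP; exists (fun A => f @` A) => A B e.
apply/seteqP; split=> x Ax.
  have [y By /finj<- //] : (f @` B) (f x) by rewrite -e; exists x.
by have [y By /finj<- //] : (f @` A) (f x) by rewrite e; exists x.
Qed.

Lemma card_leT_graph (K L : Type) : card_leT (K -> L) (set (K * L)).
Proof.
apply/card_leTP; exists (fun f => [set p | p.2 = f p.1]) => f g e; apply/funext => x.
by have : [set p : K * L | p.2 = f p.1] (x, f x) by []; rewrite e.
Qed.

(** * Well-orders, transfinite selection and successor cardinals *)

Section WellOrder.

Definition strict_well_order (T : Type) (lt : T -> T -> Prop) :=
  [/\ well_founded lt, forall x y z, lt x y -> lt y z -> lt x z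
    & forall x y, x <> y -> lt x y \/ lt y x].

Lemma exists_strict_well_order (T : Type) :
  exists lt : T -> T -> Prop, strict_well_order lt.
Proof.
have [r wo] := wochoice.well_ordering_principle {classic T}.
have woT : wochoice.wo_chain r predT by apply: wochoice.withinW.
have tot x y : r x y || r y x by exact: (wochoice.wo_chainW woT).
have anti x y : r x y -> r y x -> x = y.
  by move=> xy yx; apply: (wochoice.wo_chain_antisymmetric woT); rewrite ?xy.
have minE (A : set T) : A !=set0 -> exists2 z, A z & forall x, A x -> r z x.
  move=> [a Aa]; have [|z [[Az zmin] _]] := wo [pred x | `[< A x >]].
    by exists a; exact/asboolP.
  exists z; first exact/asboolP.
  by move=> x Ax; apply: zmin; exact/asboolP.
exists (fun x y => r x y /\ x <> y); split.
- move=> x; apply: contrapT => nx.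
  have [z nz zmin] :=
    minE [set z | ~ Acc (fun x y => r x y /\ x <> y) z] (ex_intro _ x nx).
  apply: nz; constructor => y [yz ynz]; apply: contrapT => ny.
  by apply: ynz; apply: anti => //; exact: zmin.
- move=> x y z [xy nxy] [yz nyz]; split; last first.
    by move=> xz; apply: nxy; apply: anti => //; rewrite xz.
  (* Transitivity comes from the least of the three elements: were it [y] or [z], antisymmetry would
     give [x = y] or [y = z]. *)
  have [w [->|[->|->]] wmin] := minE [set w | w = x \/ w = y \/ w = z]
    (ex_intro _ x (or_introl erefl)).
  + by apply: wmin; right; right.
  + by case: nxy; apply: anti => //; apply: wmin; left.
  + by case: nyz; apply: anti => //; apply: wmin; right; left.
- move=> x y nxy; have /orP[xy|yx] := tot x y; [left|right] => //; split=> //.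
  by move=> yxE; exact: nxy.
Qed.

Lemma wf_preimage (T U : Type) (f : T -> U) (lt : U -> U -> Prop) :
  well_founded lt -> well_founded (fun x y => lt (f x) (f y)).
Proof.
move=> wf x; have [y yE] : exists y, y = f x by exists (f x).
elim: y / (wf y) x yE => y _ IH x yE; constructor=> z zx.
by apply: (IH (f z)) => //; rewrite yE.
Qed.

Lemma exists_least (T : Type) (lt : T -> T -> Prop) (P : T -> Prop) :
  well_founded lt -> (exists x, P x) ->
  exists2 x, P x & forall y, lt y x -> ~ P y.
Proof.
move=> wf [x Px]; apply: contrapT => H.
suff : forall x, ~ P x by move/(_ x).
apply: (well_founded_ind wf) => y IH Py.
by apply: H; exists y.
Qed.

(** The value at [x] is chosen in [A x] away from all values taken below [x]. Distinct indices are
    comparable, so the later one avoids the earlier. *)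
Lemma injective_recursion (T Y : Type) (lt : T -> T -> Prop) (A : T -> set Y) :
  strict_well_order lt ->
  (forall x (g : {y | lt y x} -> Y), exists2 a, A x a & forall y, g y <> a) ->
  exists2 f : T -> Y, injective f & forall x, A x (f x).
Proof.
move=> [wf _ tri] H.
pose F x (rec : forall y, lt y x -> Y) : Y :=
  projT1 (cid2 (H x (fun y => rec (sval y) (svalP y)))).
pose f := Fix wf (fun=> Y) F.
have fE x : f x = F x (fun y _ => f y).
  apply: Fix_eq => z g h gh; congr F.
  by apply/functional_extensionality_dep => y; apply/functional_extensionality_dep.
have fP x : A x (f x) /\ forall y, lt y x -> f y <> f x.
  rewrite [f x]fE /F; case: cid2 => a Aa /= na; split=> // y yx.
  exact: (na (exist _ y yx)).
exists f => [x y e|x]; last by case: (fP x).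
by apply: contrapT => /tri[] /((fP _).2 _); rewrite e.
Qed.

(** An injective recursion from [K] into [L] gets stuck only at an [x] below which the values
    already exhaust [L]; the segment of [x] then surjects onto [L]. *)
Lemma card_leT_or_segment (K L : Type) (lt : K -> K -> Prop) :
  strict_well_order lt ->
  card_leT K L \/ exists x, card_leT L {y | lt y x}.
Proof.
move=> wo; have [|H] := pselect (exists x, card_leT L {y | lt y x}); first by right.
left; apply/card_leTP; have [x g|f finj _] := @injective_recursion K L lt (fun=> setT) wo.
  apply: contrapT => na; apply: H; exists x; apply: (card_leT_surj (f := g)) => l.
  by apply: contrapT => nl; apply: na; exists l => // y gy; apply: nl; exists y.
by exists f.
Qed.

Lemma sval_inj (K : Type) (P : K -> Prop) : injective (@sval K P).
Proof.
by move=> [x Px] [y Py] /= xy; case: y / xy Py => Py; rewrite (Prop_irrelevance Px Py).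
Qed.

Lemma card_leT_sub (K : Type) (P : set K) : card_leT {y | P y} K.
Proof. by apply/card_leTP; exists sval; exact: sval_inj. Qed.

Lemma card_leT_total (K L : Type) : card_leT K L \/ card_leT L K.
Proof.
have [lt wo] := exists_strict_well_order K.
have [|[x xL]] := card_leT_or_segment L wo; [by left|right].
exact: card_leT_trans xL (card_leT_sub _).
Qed.

(** This realizes |T| as an initial ordinal. If some segment of a well-order is as large as [T], the
    order is pulled back along an injection of [T] into the least such segment. *)
Lemma exists_initial_well_order (T : Type) :
  exists2 lt : T -> T -> Prop, strict_well_order lt &
    forall x, ~ card_leT T {y | lt y x}.
Proof.
have [lt [wf tr tri]] := exists_strict_well_order T.
have [|H] := pselect (exists x, card_leT T {y | lt y x}); last first.
  by exists lt => // x xT; apply: H; exists x.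
move=> /(exists_least wf)[x /card_leTP[e einj] xmin].
exists (fun y z => lt (sval (e y)) (sval (e z))).
  split=> [|y z w|y z yz].
  - exact: (@wf_preimage _ _ (fun y => sval (e y)) lt wf).
  - exact: tr.
  - by apply: tri => /sval_inj/einj.
move=> y /card_leTP[h hinj]; apply: (xmin (sval (e y)) (svalP (e y))).
apply/card_leTP; exists (fun z => exist _ (sval (e (sval (h z)))) (svalP (h z))).
move=> z w /(congr1 sval) /= /sval_inj.
by move=> /einj/sval_inj/hinj.
Qed.

(** Along an initial well-order of [J], the points used before a given stage are fewer than |J|, so
    they cannot exhaust [A j]. *)
Lemma injective_selection (J Y : Type) (A : J -> set Y) :
  (forall j, [set: J] #<= A j) ->
  exists2 f : J -> Y, injective f & forall j, A j (f j).
Proof.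
move=> JA; have [lt wo small] := exists_initial_well_order J.
apply: (injective_recursion wo) => x g; apply: contrapT => na; apply: (small x).
have /card_setTP[h hinj hA] := JA x.
have gh j : exists y, g y = h j.
  by apply: contrapT => ny; apply: na; exists (h j) => // y gy; apply: ny; exists y.
apply/card_leTP; exists (fun j => projT1 (cid (gh j))) => j k e; apply: hinj.
by rewrite -(projT2 (cid (gh j))) e (projT2 (cid (gh k))).
Qed.

Lemma not_card_leT_set (K : Type) : ~ card_leT (set K) K.
Proof.
move=> /card_leTP[f finj].
pose D := [set x | exists2 A : set K, x = f A & ~ A x].
have nD : ~ D (f D) by move=> /[dup] DfD [A /finj <-].
by apply: (nD); exists D.
Qed.

Lemma card_ltTE (K L : Type) : card_ltT K L <-> ~ card_leT L K.
Proof.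
split=> [[]//|nLK]; split=> //.
by have [//|/nLK] := card_leT_total K L.
Qed.

(* [D], the set of the [x] whose initial segment has size at most |K|, is the
   ordinal |K|^+ inside a well-ordering of [set K]. *)
Lemma exists_succ_card (K : Type) : exists L, is_succ_card K L.
Proof.
have [lt [wf tr tri]] := exists_strict_well_order (set K).
pose D := [set x | card_leT {y | lt y x} K].
have Dsmall x : D x -> card_leT {y | lt y x} K by [].
exists {y | D y}; split; first apply/card_ltTE.
  have [[x nDx]|H] := pselect (exists x, ~ D x); last first.
    move=> DK; apply: (@not_card_leT_set K); apply: card_leT_trans DK.
    have DT x : D x by apply: contrapT => nDx; apply: H; exists x.
    by apply/card_leTP; exists (fun x => exist _ x (DT x)) => x y /(congr1 sval).
  have [{nDx}x nDx xmin] := @exists_least _ _ (fun x => ~ D x) wf (ex_intro _ x nDx).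
  have sub y : lt y x -> D y by move=> /xmin/contrapT.
  move=> DK; apply: nDx; apply: card_leT_trans DK; apply/card_leTP.
  exists (fun y : {y | lt y x} => exist _ (sval y) (sub _ (svalP y))) => y z /(congr1 sval) /=.
  by exact: sval_inj.
move=> L /card_ltTE nLK.
pose ltD (y z : {y | D y}) := lt (sval y) (sval z).
have woD : strict_well_order ltD.
  split=> [|y z w|y z yz]; first exact: (@wf_preimage _ _ sval lt wf).
  - exact: tr.
  - by apply: tri => /sval_inj.
have [//|[x Lx]] := card_leT_or_segment L woD.
case: nLK; apply: card_leT_trans Lx _.
apply: card_leT_trans (Dsmall _ (svalP x)).
apply/card_leTP; exists (fun y : {y | ltD y x} =>
  exist (fun z => lt z (sval x)) (sval (sval y)) (svalP y)) => y z.
move=> /(congr1 sval) /= /sval_inj.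
by move=> /sval_inj.
Qed.

End WellOrder.

(** * Cantor schemes, with bit sequences standing for the continuum *)

Definition cantor_seq := nat -> bool.

Lemma card_leT_cantor_set : card_leT (set nat) cantor_seq.
Proof.
apply/card_leTP; exists (fun A n => `[< A n >]) => A B e.
have en n : `[< A n >] = `[< B n >] by exact: (congr1 (@^~ n) e).
by apply/seteqP; split=> n /asboolP; [rewrite en|rewrite -en] => /asboolP.
Qed.

Lemma uncountable_cantor_le (T : Type) (A : set T) :
  [set: cantor_seq] #<= A -> ~ countable A.
Proof.
move=> CA cA; apply: (@not_card_leT_set nat).
apply: card_leT_trans card_leT_cantor_set _.
exact: card_le_trans CA cA.
Qed.

Lemma countable_setU (T : Type) (A B : set T) :
  countable A -> countable B -> countable (A `|` B).
Proof.
by move=> cA cB; rewrite -bigcup2E; apply: bigcup_countable => // -[|[|n]].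
Qed.

Lemma nested_compact_nonempty (T : topologicalType) (K : nat -> set T) :
  hausdorff_space T -> (forall n, compact (K n)) -> (forall n, K n !=set0) ->
  (forall n, K n.+1 `<=` K n) -> \bigcap_n K n !=set0.
Proof.
move=> hT cK K0 KS.
have KSn m n : (m <= n)%N -> K n `<=` K m.
  by move=> /subnK <-; elim: (n - m)%N => [//|k IH] x /KS/IH.
have /choice[x xK] : forall n, exists x, K n x by [].
have [p [_ px]] := cK 0%N (x @ \oo) _
  (ex_intro2 _ _ 0%N I (fun n _ => KSn 0%N n isT _ (xK n))).
exists p => n _; apply: (compact_closed hT (cK n)) => B nB.
by apply: px => //; exists n => // m /= nm; exact: KSn (xK m).
Qed.

(** A Cantor scheme: each bit sequence selects a decreasing sequence of compact members of [C],
    hence a point of their intersection, and two sequences are separated at the first bit where they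
    differ. *)
Lemma splitting_family_card (T : topologicalType) (C : set (set T)) (K : set T) :
  hausdorff_space T -> (forall L, C L -> compact L /\ L !=set0) ->
  (forall L, C L -> exists L0 L1 : set T,
    [/\ C L0, C L1, L0 `<=` L, L1 `<=` L & L0 `&` L1 = set0]) ->
  C K -> [set: cantor_seq] #<= K.
Proof.
move=> hT Ccpt Csplit CK.
have /choice[s sP] : forall L, exists s : bool -> set T, C L ->
    (forall b, C (s b) /\ s b `<=` L) /\ s true `&` s false = set0.
  move=> L; have [CL|nCL] := pselect (C L); last by exists (fun=> L).
  have [L1 [L0 [CL1 CL0 L1L L0L L10]]] := Csplit L CL.
  by exists (fun b => if b then L1 else L0) => _; split=> // -[].
(* [N b n] is the member of [C] reached after the first [n] bits of [b]. *)
pose N b := fix N n := if n is m.+1 then s (N m) (b m) else K.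
have CN b n : C (N b n) by elim: n => //= n IH; case: (sP _ IH) => /(_ (b n))[].
have /choice[f fP] : forall b, exists x, (\bigcap_n N b n) x.
  move=> b; apply: nested_compact_nonempty => // n; try by have [] := Ccpt _ (CN b n).
  by have [/(_ (b n))[]] := sP _ (CN b n).
apply/card_setTP; exists f => [b b' ff|b]; last exact: (fP b 0%N I).
(* If the sets agree at stage [n], different bits would put the common point [f b = f b'] in two
   disjoint halves. *)
have step n : N b n = N b' n -> b n = b' n.
  move=> Nbb'; have := fP b n.+1 I; have := fP b' n.+1 I; rewrite -ff /= -Nbb'.
  have [_] := sP _ (CN b n); case: (b n) (b' n) => -[] // /seteqP[s0 _].
    by move=> sf st; case: (s0 (f b)).
  by move=> st sf; case: (s0 (f b)).
apply/funext => n; apply: (step).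
by elim: n => //= n IH; rewrite (step _ IH) IH.
Qed.

(* The sets containing all but countably many points of [K] form a proper
   filter; its cluster points are the condensation points of [K]. *)
Lemma compact_condensation_point (T : topologicalType) (K : set T) :
  compact K -> ~ countable K ->
  exists2 p, K p & forall U, nbhs p U -> ~ countable (K `&` U).
Proof.
move=> cK uK; pose F := [set A : set T | countable (K `\` A)].
have FF : ProperFilter F.
  split; first by rewrite /F /= setD0.
  split=> [|A B FA FB|A B AB].
  - by rewrite /F /= setDT; exact: countable0.
  - by rewrite /F /= setDIr; exact: countable_setU.
  - by apply: sub_countable; apply: subset_card_le => x [Kx nBx]; split=> // /AB.
have FK : F K by rewrite /F /= setDv; exact: countable0.
have [p [Kp pF]] := cK _ FF FK; exists p => // U pU cU.
have : F (~` U) by rewrite /F /= setDE setCK.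
by move=> /pF/(_ pU)[x []].
Qed.

(** * Cantor schemes inside uncountable compact sets and perfect sets *)

Section Normed.
Variables (R : realType) (V : normedModType R).
Implicit Types (K P U : set V) (p q : V).

Lemma disjoint_closed_balls p q : p <> q ->
  exists2 r : R, 0 < r & closed_ball p r `&` closed_ball q r = set0.
Proof.
move=> pq; have d0 : 0 < `|p - q| by rewrite normr_gt0 subr_eq0; exact/eqP.
(* A third of the distance, since closed balls of half the distance could touch. *)
exists (`|p - q| / 3); first by rewrite divr_gt0.
rewrite -subset0 => x; rewrite !closed_ballE ?divr_gt0//= /closed_ball_ /= => -[px qx].
have := ler_distD x p q; rewrite (distrC x q) => pxq.
by exfalso; clear pq; lra.
Qed.

Lemma nbhs_closed_ball p (r : R) : 0 < r -> nbhs p (closed_ball p r).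
Proof.
by move=> r0; apply: filterS (nbhsx_ballx p _ r0); exact: subset_closed_ball.
Qed.

(* For a condensation point [p], some compact [K `\` ball p _] is uncountable
   and yields a second condensation point. *)
Lemma uncountable_compact_split K : compact K -> ~ countable K ->
  exists K0 K1 : set V, [/\ compact K0 /\ ~ countable K0,
    compact K1 /\ ~ countable K1, K0 `<=` K, K1 `<=` K & K0 `&` K1 = set0].
Proof.
move=> cK uK; have [p Kp pc] := compact_condensation_point cK uK.
have [n un] : exists n, ~ countable (K `\` ball p (n.+1%:R^-1 : R)).
  apply: contrapT => H; apply: uK.
  apply: (@sub_countable _ _ _
      ([set p] `|` \bigcup_n (K `\` ball p (n.+1%:R^-1 : R)))).
    apply: subset_card_le => x Kx; have [->|/eqP xp] := eqVneq x p; first by left.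
    right; have d0 : 0 < `|p - x| by rewrite normr_gt0 subr_eq0; exact/eqP/nesym.
    have [n _ nd] := near_infty_natSinv_lt (PosNum d0).
    exists n => //; split=> //; rewrite -ball_normE /= => /(lt_trans (nd n (leqnn n))).
    by rewrite ltxx.
  apply: countable_setU; first exact: countable1.
  apply: bigcup_countable => // n _; apply: contrapT => nn; apply: H; by exists n.
have cL : compact (K `\` ball p (n.+1%:R^-1 : R)).
  by rewrite setDE; apply: compact_closedI => //; apply: open_closedC; exact: ball_open.
have [q [Kq qp] qc] := compact_condensation_point cL un.
have [|r r0 pq0] := @disjoint_closed_balls p q.
  by move=> pq; apply: qp; rewrite -pq; exact: ballxx.
exists (K `&` closed_ball p r), (K `&` closed_ball q r); split.
- split; first by apply: compact_closedI => //; exact: closed_ball_closed.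
  by apply: pc; exact: nbhs_closed_ball.
- split; first by apply: compact_closedI => //; exact: closed_ball_closed.
  move=> cq; apply: (qc (closed_ball q r)); first exact: nbhs_closed_ball.
  by apply: sub_countable cq; apply: subset_card_le => x [[]].
- exact: subIsetl.
- exact: subIsetl.
- by rewrite setIACA pq0 setI0.
Qed.

Lemma uncountable_compact_card K : compact K -> ~ countable K ->
  [set: cantor_seq] #<= K.
Proof.
move=> cK uK.
apply: (@splitting_family_card V [set L | compact L /\ ~ countable L]) => //.
- move=> L [cL uL]; split=> //; apply/set0P/eqP => L0; apply: uL.
  by rewrite L0; exact: countable0.
- by move=> L [cL uL]; exact: uncountable_compact_split.
Qed.

(** Every member of the scheme keeps a nonempty relatively open piece of [P]. As [P] has no isolated
    point, the piece contains two points, and disjoint closed balls around them split the member. *)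
Lemma perfect_compact_card P U K : perfect_set P -> open U ->
  U `&` P !=set0 -> compact K -> U `&` P `<=` K -> K `<=` P ->
  [set: cantor_seq] #<= K.
Proof.
move=> [_ PE] oU UP cK UK KP.
pose C := [set L : set V | compact L /\ exists W : set V,
  [/\ open W, W `&` P !=set0, W `&` P `<=` L & L `<=` P]].
apply: (@splitting_family_card V C) => //; last by split=> //; exists U.
- by move=> L [cL [W [_ [x Wx] WL _]]]; split=> //; exists x; exact: WL.
move=> L [cL [W [oW [p [Wp Pp]] WL LP]]].
have : limit_point P p by rewrite PE.
move=> /(_ W (open_nbhs_nbhs (conj oW Wp)))[q [qp Pq Wq]].
have [|r r0 pq0] := @disjoint_closed_balls p q; first by move/eqP: qp => /nesym.
have sub x : W x -> P x -> C (L `&` closed_ball x r).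
  move=> Wx Px; split; first by apply: compact_closedI => //; exact: closed_ball_closed.
  exists (W `&` ball x r); split.
  - by apply: openI => //; exact: ball_open.
  - by exists x; split=> //; split=> //; exact: ballxx.
  - move=> y [[Wy xy] Py]; split; first exact: WL.
    exact: subset_closed_ball.
  - by move=> y [/LP].
exists (L `&` closed_ball p r), (L `&` closed_ball q r); split.
- exact: sub.
- exact: sub.
- exact: subIsetl.
- exact: subIsetl.
- by rewrite setIACA pq0 setI0.
Qed.

End Normed.

(** * Comparison with the continuum: reals, row vectors, closed sets, projections *)

Lemma card_leT_countable_cantor (I : countType) :
  card_leT (I -> cantor_seq) cantor_seq.
Proof.
apply/card_leTP.
exists (fun f k => if unpickle k is Some p then f p.1 p.2 else false).
move=> f g e; apply/funext => i; apply/funext => m.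
by have := congr1 (@^~ (pickle (i, m))) e; rewrite /= pickleK.
Qed.

Lemma card_leT_pair_cantor (K L : Type) :
  card_leT K cantor_seq -> card_leT L cantor_seq -> card_leT (K * L) cantor_seq.
Proof.
move=> KC LC; apply: card_leT_trans (card_leT_prod KC LC) _.
apply: card_leT_trans (card_leT_countable_cantor bool).
apply/card_leTP; exists (fun p b => if b then p.1 else p.2) => -[a b] [c d] e.
by move: (congr1 (@^~ true) e) (congr1 (@^~ false) e) => /= -> ->.
Qed.

(** A closed set is determined by which of the countably many balls with centre [d i] and radius
    1/(m+1) meet it. *)
Lemma card_leT_closed_cantor (R : realType) (T : pseudoMetricType R)
    (I : countType) (d : I -> T) :
  (forall x (e : R), 0 < e -> exists i, ball x e (d i)) ->
  card_leT {F : set T | closed F} cantor_seq.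
Proof.
move=> dense; pose meets (F : set T) (i : I) (m : nat) :=
  exists2 x, F x & ball (d i) (m.+1%:R^-1 : R) x.
have sub F F' : closed F' -> (forall i m, meets F i m -> meets F' i m) ->
    F `<=` F'.
  move=> cF' FF' x Fx; apply: contrapT => nF'x.
  have /nbhs_ballP[e /= e0 xe] : nbhs x (~` F').
    by apply: open_nbhs_nbhs; split=> //; exact: closed_openC.
  have e20 : 0 < e / 2 by rewrite divr_gt0.
  have [m _ /(_ m (leqnn m)) me] := near_infty_natSinv_lt (PosNum e20).
  have [i xi] := dense x (m.+1%:R^-1 : R) (ltac:(by [])).
  have [|y F'y iy] := FF' i m; first by exists x => //; exact: ball_sym.
  apply: (xe y) => //.
  apply: ball_splitr (le_ball (ltW me) _) (le_ball (ltW me) iy).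
  exact: ball_sym.
apply/card_leTP; exists (fun F k =>
  if unpickle k is Some p then `[< meets (sval F) p.1 p.2 >] else false).
move=> F F' e; apply: sval_inj.
have E i m : `[< meets (sval F) i m >] = `[< meets (sval F') i m >].
  by have := congr1 (@^~ (pickle (i, m))) e; rewrite /= pickleK.
by apply/seteqP; split; apply: sub => [|i m /asboolP]; first [exact: svalP
  | rewrite E => /asboolP | rewrite -E => /asboolP].
Qed.

Section Cardinals.
Variable R : realType.

(** A real is coded by its Dedekind cut in the rationals. *)
Lemma card_leT_real_cantor : card_leT R cantor_seq.
Proof.
apply/card_leTP.
exists (fun x k => if unpickle k is Some q then (ratr q : R) < x else false).
have sub (x y : R) : (forall q, ((ratr q : R) < x) = (ratr q < y)) -> x <= y.
  move=> xy; rewrite leNgt; apply/negP => /rat_in_itvoo[q].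
  by rewrite in_itv /= => /andP[yq]; rewrite xy => /(lt_trans yq); rewrite ltxx.
move=> x y e.
have E (q : rat) : ((ratr q : R) < x) = (ratr q < y).
  by have := congr1 (@^~ (pickle q)) e; rewrite /= pickleK.
by apply/eqP; rewrite eq_le !sub.
Qed.

Lemma card_leT_rV_cantor n : card_leT 'rV[R]_n cantor_seq.
Proof.
apply: card_leT_trans (card_leT_countable_cantor 'I_n).
apply: card_leT_trans (card_leT_fun _ card_leT_real_cantor).
apply/card_leTP; exists (fun v i => v ord0 i) => v w e.
by apply/rowP => i; exact: (congr1 (@^~ i) e).
Qed.

Lemma card_leT_closed_rV_cantor n :
  card_leT {F : set ('rV[R]_n * R) | closed F} cantor_seq.
Proof.
have rat_dense (x e : R) : 0 < e -> exists q : rat, ball x e (ratr q).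
  move=> e0; have [|q] := @rat_in_itvoo R (x - e) (x + e); first by lra.
  rewrite in_itv /= => /andP[xq qx]; exists q.
  by rewrite -ball_normE /= ltr_distlC; apply/andP; split; lra.
apply: (@card_leT_closed_cantor R ('rV[R]_n * R)%type ('rV[rat]_n * rat)%type
  (fun q => (map_mx ratr q.1, ratr q.2))).
move=> [v x] e e0; have [s xs] := rat_dense x e e0.
have /choice[q vq] : forall i, exists q : rat, ball (v ord0 i) e (ratr q).
  by move=> i; exact: rat_dense.
exists (\row_i q i, s); split=> //=; split=> // i j.
by rewrite !mxE ord1; exact: vq.
Qed.

Lemma perfect_rV n : perfect_set [set: 'rV[R]_n.+1].
Proof.
apply/perfectTP => v ov.
have /nbhs_ballP[e /= e0 ve] : nbhs v [set v] by exact: open_nbhs_nbhs.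
(* Shifting every coordinate by [e / 2] stays in the ball, and moves [v] because there is at least
   one coordinate. *)
have /ve /= : ball v e (v + const_mx (e / 2)).
  split=> // i j; rewrite !mxE -ball_normE /=.
  rewrite opprD addrA subrr sub0r normrN gtr0_norm; lra.
by move=> /matrixP/(_ ord0 ord0); rewrite !mxE; lra.
Qed.

Lemma closed_ball_rV_compact n (v : 'rV[R]_n) (r : R) : 0 < r ->
  compact (closed_ball v r).
Proof.
move=> r0; apply: bounded_closed_compact; last exact: closed_ball_closed.
rewrite closed_ballE//; exists (`|v| + r); split; first exact: num_real.
move=> x xM y; rewrite /closed_ball_ /= => vy.
rewrite (le_trans _ (ltW xM))// -(subKr v y) (le_trans (ler_normB _ _))//.
by rewrite lerD.
Qed.

(** Serves open sets when [P] is the whole space, and perfect sets when [U] is. *)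
Lemma perfect_rV_card n (P U : set 'rV[R]_n) : perfect_set P -> open U ->
  U `&` P !=set0 ->
  exists K, [/\ compact K, K `<=` U `&` P & [set: cantor_seq] #<= K].
Proof.
move=> pP oU [p [Up Pp]].
have /nbhs_ballP[e /= e0 pe] : nbhs p U by exact: open_nbhs_nbhs.
have e20 : 0 < e / 2 by rewrite divr_gt0.
have cK : compact (closed_ball p (e / 2) `&` P).
  apply: compact_closedI; last by case: pP.
  exact: closed_ball_rV_compact.
exists (closed_ball p (e / 2) `&` P); split=> //.
  by move=> x [px Px]; split=> //; apply: pe; apply: closed_ball_subset px; lra.
apply: (perfect_compact_card pP (ball_open p (e / 2))) => //.
- by exists p; split=> //; exact: ballxx.
- by move=> x [/subset_closed_ball].
Qed.

Lemma card_leT_cantor_rV n : card_leT cantor_seq 'rV[R]_n.+1.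
Proof.
have [|K [_ _ CK]] := perfect_rV_card (perfect_rV n) openT; first by exists 0.
exact: card_le_trans CK (cardinality.card_leT _).
Qed.

Lemma card_leT_cantor_real : card_leT cantor_seq R.
Proof.
apply: card_leT_trans (card_leT_cantor_rV 0) _; apply/card_leTP.
by exists (fun v => v ord0 ord0) => v w vw; apply/rowP => i; rewrite ord1.
Qed.

(** [F] is a countable union of compact pieces, so one of them has an uncountable projection; that
    projection is compact, being a continuous image. *)
Lemma closed_projection_card n (F : set ('rV[R]_n * R)) :
  closed F -> ~ countable (fst @` F) -> [set: cantor_seq] #<= fst @` F.
Proof.
move=> cF uF.
pose B k := closed_ball (0 : 'rV[R]_n) k.+1%:R `*` closed_ball (0 : R) k.+1%:R.
have [k uk] : exists k, ~ countable (fst @` (B k `&` F)).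
  apply: contrapT => H; apply: uF.
  apply: (@sub_countable _ _ _ (\bigcup_k (fst @` (B k `&` F)))).
    apply: subset_card_le => _ [[v x] Fvx <-].
    have [k _ /(_ k (leqnn k)) /= kE] := nbhs_infty_ger (Num.max `|v| `|x|).
    exists k => //; exists (v, x) => //; split=> //.
    rewrite ge_max in kE; case/andP: kE => vk xk.
    by split; apply: subset_closed_ball; rewrite -ball_normE /= sub0r normrN
      (le_lt_trans vk, le_lt_trans xk)// ltr_nat.
  apply: bigcup_countable => // k _; apply: contrapT => nk; apply: H; by exists k.
have cK : compact (fst @` (B k `&` F)).
  apply: continuous_compact; last first.
    apply: compact_closedI => //; apply: compact_setX.
      exact: closed_ball_rV_compact.
    exact: closed_ballR_compact.
  by apply: continuous_subspaceT => x; exact: cvg_fst.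
apply: card_le_trans (uncountable_compact_card cK uk) _.
by apply: subset_card_le => _ [p [_ Fp] <-]; exists p.
Qed.

End Cardinals.

(** * Extension of independent sets to Hamel bases *)

Section HamelBasis.
Variables (F : fieldType) (V : lmodType F).
Implicit Types (W B : set V).

Lemma sub_lin_span B : B `<=` lin_span B.
Proof.
move=> v Bv; exists [:: v], (fun=> 1); split; last by rewrite big_seq1 scale1r.
by move=> u; rewrite /= inE => /eqP->.
Qed.

Lemma lin_indep_setU1 B w : lin_indep B -> ~ lin_span B w ->
  lin_indep (B `|` [set w]).
Proof.
move=> indB nw s c us sB sum0.
have [ws|nws] := boolP (w \in s); last first.
  apply: indB => // u su; have [//|uw] := sB u su.
  by move: su nws; rewrite /= uw => ->.
have remB : [set` rem w s] `<=` B.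
  move=> u /=; rewrite mem_rem_uniq// !inE => /andP[/eqP uw su].
  by have [|/uw] := sB u su.
move: sum0; rewrite (big_rem w)//= => sum0.
have cw0 : c w = 0.
  apply: contrapT => /eqP cw0; apply: nw.
  exists (rem w s), (fun u => - (c w)^-1 * c u); split=> //.
  transitivity (- (c w)^-1 *: \sum_(u <- rem w s) c u *: u); last first.
    by rewrite scaler_sumr; apply: eq_bigr => u _; rewrite scalerA.
  move/eqP: sum0; rewrite addrC addr_eq0 => /eqP->.
  by rewrite scalerN scaleNr opprK scalerA mulVf// scale1r.
move: sum0; rewrite cw0 scale0r add0r => sum0 u su.
have [->//|uw] := eqVneq u w.
apply: (indB _ c (rem_uniq w us) remB sum0).
by rewrite mem_rem_uniq// !inE uw.
Qed.

(** The chain condition for Zorn: independence is tested on finite sequences, and a finite sequence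
    in the union of a chain already lies in one member. *)
Lemma chain_seq_cover B (C : set (set V)) X0 (s : seq V) :
  total_on C subset -> C X0 -> [set` s] `<=` B `|` \bigcup_(X in C) X ->
  exists2 X, C X & [set` s] `<=` B `|` X.
Proof.
move=> totC CX0; elim: s => [|v s IH] sB; first by exists X0.
have [|X CX sX] := IH; first by move=> u su; apply: sB; rewrite /= inE su orbT.
have [Bv|[Y CY Yv]] : (B `|` \bigcup_(X in C) X) v by apply: sB; rewrite /= mem_head.
  by exists X => // u; rewrite /= inE => /predU1P[->|/sX//]; left.
have [XY|YX] := totC _ _ CX CY.
  exists Y => // u; rewrite /= inE => /predU1P[->|/sX[]]; [by right|by left|].
  by move=> /XY; right.
by exists X => // u; rewrite /= inE => /predU1P[->|/sX//]; right; exact: YX.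
Qed.

Lemma lin_span_submod W B : GRing.submod_closed [in W] -> B `<=` W ->
  lin_span B `<=` W.
Proof.
move=> [W0 WD] BW _ [s [c [sB ->]]].
elim: s sB => [|v s IH] sB; first by rewrite big_nil -inE.
rewrite big_cons -inE; apply: WD; rewrite inE.
  by apply/BW/sB; rewrite /= mem_head.
by apply: IH => u su; apply: sB; rewrite /= inE su orbT.
Qed.

Lemma exists_hamel_basis W B : GRing.submod_closed [in W] -> B `<=` W ->
  lin_indep B -> exists2 H, hamel_basis W H & B `<=` H.
Proof.
(* Zorn is applied to the sets added to [B], so that the empty union of an empty chain is admissible
   too. *)
move=> subW BW indB; pose P := [set X | X `<=` W /\ lin_indep (B `|` X)].
have [C CP totC|A [[AW indA] maxA]] := @Zorn_bigcup V P.
  split; first by move=> v [X /CP[XW _]] /XW.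
  have [[X0 CX0]|C0] := pselect (exists X, C X); last first.
    suff -> : \bigcup_(X in C) X = set0 by rewrite setU0.
    by rewrite -subset0 => v [X CX]; case: C0; exists X.
  move=> s c us sB; have [X /CP[_ indX] sX] := chain_seq_cover totC CX0 sB.
  exact: indX.
have BAW : B `|` A `<=` W by rewrite subUset.
exists (B `|` A); last exact: subsetUl.
split=> //; apply/seteqP; split; first exact: lin_span_submod.
move=> w Ww; apply: contrapT => nw; apply: (maxA (A `|` [set w])).
  split; first exact: subsetUl.
  by move=> /(_ w (or_intror erefl)) Aw; apply: nw; apply: sub_lin_span; right.
split; first by rewrite subUset; split=> // _ ->.
by rewrite setUA; exact: lin_indep_setU1.
Qed.

End HamelBasis.

(** * Pointwise closed spaces of weighted pullbacks, and independent indicators *)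

Section FunctionSpaceOfWeights.
Variables (R : realType) (X : eqType) (I : Type).

(* Every pointwise closed subspace of [X -> R] is the space of all [l \o phi]
   with [l] a linear form on some vector space [E] and [phi : X -> E].  Here
   [E] has a basis indexed by [I] and [phi x] is [s x] times the basis vector of
   index [i x], while [l] is given by its values [a] on the basis. *)
Definition weighted_pullbacks (s : X -> R) (i : X -> I) : set (X -> R) :=
  [set f | exists a : I -> R, f = fun x => s x * a (i x)].

Lemma weighted_pullbacks_submod s i :
  GRing.submod_closed [in weighted_pullbacks s i].
Proof.
split; first by rewrite inE; exists (fun=> 0); apply/funext => x; rewrite mulr0.
move=> c f g; rewrite !inE => -[a ->] [b ->]; exists (fun j => c * a j + b j).
by apply/funext => x; rewrite mulrDr mulrCA.
Qed.

(** The space is cut out by equations in at most two values of [f]: [f] vanishes where [s] does, and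
    [f] is proportional to [s] on each fibre of [i]. *)
Lemma weighted_pullbacks_closed s i :
  closed (weighted_pullbacks s i : set {ptws X -> R}).
Proof.
pose Z x : set {ptws X -> R} := [set f | s x = 0 -> f x = 0].
pose G (p : X * X) : set {ptws X -> R} :=
  [set f | s p.2 * f p.1 - s p.1 * f p.2 = 0].
have evalC (x : X) : continuous (fun f : {ptws X -> R} => f x).
  exact: (@proj_continuous X (fun=> R) x).
have mulC (c : R) x : continuous (fun f : {ptws X -> R} => c * f x).
  by move=> f; apply: (continuous_comp (evalC x f)); exact: mulrl_continuous.
suff -> : weighted_pullbacks s i = \bigcap_(x in setT) Z x `&`
    \bigcap_(p in [set p | i p.1 = i p.2]) G p.
  apply: closedI; apply: closed_bigI; [move=> x _|move=> p _].
    have [s0|s0] := pselect (s x = 0); last first.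
      by have -> : Z x = setT by apply/seteqP; split=> // f _ /s0.
    have -> : Z x = (fun f : {ptws X -> R} => f x) @^-1` [set 0].
      by apply/seteqP; split=> [f /(_ s0)|f f0 _].
    by apply: preimage_closed => [f _|]; [exact: evalC|exact: closed_eq].
  rewrite (_ : G p = (fun f : {ptws X -> R} =>
     s p.2 * f p.1 - s p.1 * f p.2) @^-1` [set 0])//.
  apply: preimage_closed => [f _|]; last exact: closed_eq.
  exact: (@cvgB _ R^o _ _ _ _ _ _ _ (mulC _ _ f) (mulC _ _ f)).
apply/seteqP; split=> [_ [a ->]|f [Zf Gf]].
  split=> [x _ /= ->|[x y] /= xy]; first by rewrite mul0r.
  by rewrite /G /= xy mulrCA subrr.
(* The coefficient at [j] is the common ratio of [f] to [s] on the fibre of [j], or 0 if [s]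
   vanishes on that fibre. *)
have /choice[a aP] : forall j, exists c : R,
    forall x, i x = j -> s x != 0 -> c = f x / s x.
  move=> j; have [[x [xj sx0]]|H] :=
    pselect (exists x, i x = j /\ s x != 0); last first.
    by exists 0 => x xj sx; case: H; exists x.
  exists (f x / s x) => y yj sy0.
  have /= /eqP := Gf (x, y) (etrans xj (esym yj)); rewrite subr_eq0 => /eqP E.
  by apply/eqP; rewrite eqr_div// mulrC E mulrC.
exists a; apply/funext => x; have [sx0|sx0] := eqVneq (s x) 0.
  by rewrite sx0 mul0r; exact: (Zf x Logic.I sx0).
by rewrite (aP (i x) x)// mulrC divfK.
Qed.

End FunctionSpaceOfWeights.

(* As in the Fichtenholz-Kantorovich family of independent sets: a finite family
   of sets is separated by the traces of its members on finitely many points. *)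
Definition trace_indicator (R : realType) (T : Type) (A : set T)
    (q : (nat -> T) * (nat -> bool)) : R :=
  (`[< forall k, A (q.1 k) <-> q.2 k >])%:R.

Lemma trace_indicator_inj (R : realType) (T : Type) :
  injective (@trace_indicator R T).
Proof.
have sub (A B : set T) : trace_indicator R A = trace_indicator R B -> A `<=` B.
  (* The constant sequence [x] with constant bit [true] tests membership of [x]. *)
  move=> e x Ax; have := congr1 (@^~ (fun=> x, fun=> true)) e.
  rewrite /trace_indicator asboolT//.
  case: asboolP => [/(_ 0%N)[_ Bx] _|_ /eqP]; first exact: Bx.
  by rewrite oner_eq0.
by move=> A B e; apply/seteqP; split; apply: sub.
Qed.

(** The [k]-th point of [q] distinguishes [A v] from the set attached to the [k]-th member of [s],
    and the bits record the trace of [A v]. *)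
Lemma trace_indicator_separates (R : realType) (T : pointedType) (V : eqType)
    (s : seq V) (A : V -> set T) (v : V) :
  {in s, forall u, u != v -> A u <> A v} ->
  exists2 q, trace_indicator R (A v) q = 1 &
    {in s, forall u, u != v -> trace_indicator R (A u) q = 0}.
Proof.
move=> Av.
have /choice[r rP] : forall u, exists x, u \in s -> u != v -> ~ (A u x <-> A v x).
  move=> u; have [[su uv]|H] := pselect (u \in s /\ u != v); last first.
    by exists point => su uv; case: H.
  apply: contrapT => nx; apply: (Av u su uv); apply/funext => x; apply/propext.
  by apply: contrapT => H; apply: nx; exists x.
(* Past the end of [s], [nth] returns [v], whose point is arbitrary; this is harmless because the
   bits follow [A v]. *)
exists (fun k => r (nth v s k), fun k => `[< A v (r (nth v s k)) >]).
  by rewrite /trace_indicator asboolT// => k /=; split=> /asboolP.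
move=> u su uv; rewrite /trace_indicator asboolF//= => /(_ (index u s)).
rewrite nth_index// => -[uv1 uv2].
by apply: (rP u su uv); split=> [/uv1/asboolP|/asboolP/uv2].
Qed.

(** * Transfinite construction of the weights *)

Section Jones.
Variables (R : realType) (n : nat).
Notation X := 'rV[R]_n.

Lemma exists_jones_weights (I : Type) (i0 : I) : card_leT I cantor_seq ->
  exists (s : X -> R) (i : X -> I), forall a : I -> R, (exists j, a j != 0) ->
    forall F : set (X * R), closed F -> ~ countable (fst @` F) ->
    [set: R] #<= [set x | F (x, s x * a (i x))].
Proof.
move=> IC.
(* The last component repeats each requirement once per real, so that [F] is met over continuum many
   points. *)
pose J := ({F : set (X * R) | closed F /\ ~ countable (fst @` F)}
  * I * R * R)%type.
pose proj (j : J) := fst @` sval j.1.1.1.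
have JC : card_leT J cantor_seq.
  do 2!(apply: card_leT_pair_cantor; last exact: card_leT_real_cantor).
  apply: card_leT_pair_cantor IC.
  apply: card_leT_trans (card_leT_closed_rV_cantor R n).
  apply/card_leTP.
  exists (fun F => exist closed (sval F) (proj1 (svalP F))) => F F' /(congr1 sval) /=.
  exact: sval_inj.
have [|x xinj xproj] := @injective_selection J X proj.
  move=> j; have [cF uF] := svalP j.1.1.1.
  exact: card_le_trans JC (closed_projection_card cF uF).
have /choice[y yF] : forall j, exists y, sval j.1.1.1 (x j, y).
  by move=> j; have [[z y] Fzy <-] := xproj j; exists y.
(* Injectivity of [x] makes this assignment consistent; points outside its range get weight 0 and
   index [i0]. *)
have /choice[d dP] : forall z, exists p : R * I, forall j, x j = z ->
    p = (j.1.2 * y j, j.1.1.2).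
  move=> z; have [[j <-]|H] := pselect (exists j, x j = z); last first.
    by exists (0, i0) => j xj; case: H; exists j.
  by exists (j.1.2 * y j, j.1.1.2) => k /xinj->.
exists (fst \o d), (snd \o d) => a [j aj0] F cF uF.
(* The factor [(a j)^-1] in the weight cancels the value [a j], leaving the height [y (t u)]
   prescribed by [F]. *)
pose t u : J := (exist _ F (conj cF uF), j, (a j)^-1, u).
apply/card_setTP; exists (x \o t) => [u v /xinj[]//|u] /=.
rewrite (dP _ (t u) erefl) /= mulrAC mulVf// mul1r.
exact: (yF (t u)).
Qed.

End Jones.

(** * Bound on dimensions and inclusions between the classes *)

Section Spaceability.
Variables (R : realType) (n : nat).
Notation X := 'rV[R]_n.
Implicit Types (F : set (X * R)) (f : X -> R).

Lemma card_leT_rV_functions : card_leT (X -> R) (set R).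
Proof.
apply: card_leT_trans (card_leT_graph _ _) _; apply: card_leT_set.
apply: card_leT_trans (card_leT_cantor_real R).
apply: card_leT_pair_cantor; [exact: card_leT_rV_cantor|exact: card_leT_real_cantor].
Qed.

(** A basis is a set of functions, and there are at most |set R| functions. *)
Lemma ptws_spaceable_card_le (M : set (X -> R)) D :
  ptws_spaceable M D -> card_leT D (set R).
Proof.
move=> [W [_ _ [B _ BD] _]]; apply: card_leT_trans card_leT_rV_functions.
by rewrite /card_leT -(card_le_eql BD); exact: cardinality.card_leT.
Qed.

Lemma sub_ptws_spaceable (M N : set (X -> R)) D :
  M `<=` N -> ptws_spaceable M D -> ptws_spaceable N D.
Proof.
move=> MN [W [? ? ? WM]]; exists W; split=> //.
by apply: subset_trans WM _; exact: setSU.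
Qed.

(* The multiplicity is what gives [SES] directly, on taking [F] of the form
   [K `*` [set y]]. *)
Definition strong_Jones : set (X -> R) :=
  [set f | forall F, closed F -> ~ countable (fst @` F) ->
     [set: R] #<= [set x | F (x, f x)]].

Lemma strong_Jones_sub_Jones : strong_Jones `<=` @Jones R n.
Proof.
move=> f Jf F cF uF; have /card_setTP[x _ /(_ 0) Fx] := Jf F cF uF.
by exists (x 0, f (x 0)).
Qed.

Lemma closed_setX_point (P : set X) (y : R) : closed P -> closed (P `*` [set y]).
Proof.
move=> cP; rewrite (_ : _ `*` _ = fst @^-1` P `&` snd @^-1` [set y])//.
apply: closedI.
  by apply: preimage_closed => // p _; exact: cvg_fst.
by apply: preimage_closed => [p _|]; [exact: cvg_snd|exact: closed_eq].
Qed.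

Lemma fst_setX_point (P : set X) (y : R) : fst @` (P `*` [set y]) = P.
Proof. by apply/seteqP; split=> [_ [p [Pp _] <-]//|x Px]; exists (x, y). Qed.

(** The function meets the closed copy of [P] at height [y], whose projection [P] contains a copy of
    the Cantor set of sequences. *)
Lemma Jones_sub_PES : @Jones R n `<=` @PES R n.
Proof.
move=> f Jf P pP [p Pp]; apply/seteqP; split=> // y _.
have [|K [_ KP CK]] := perfect_rV_card pP openT; first by exists p.
have [| |[x z] [/= zE [/= Px zy]]] := Jf (P `*` [set y]).
- by apply: closed_setX_point; case: pP.
- rewrite fst_setX_point => cP; apply: (uncountable_cantor_le CK).
  by apply: sub_countable cP; apply: subset_card_le => x /KP[].
- by exists x => //; rewrite -zE.
Qed.

Lemma SES_sub_ES : @SES R n `<=` @ES R n.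
Proof.
move=> f Sf G oG G0; apply/seteqP; split=> // y _.
have /card_eqPle[_ /card_setTP[x _ /(_ 0)[fx Gx]]] := Sf y G oG G0.
by exists (x 0).
Qed.

End Spaceability.

(** * The closed subspace of dimension |set R| and the value of L_p *)

Section Main.
Variables (R : realType) (n : nat).
Notation X := 'rV[R]_n.+1.

Lemma strong_Jones_sub_SES : @strong_Jones R n.+1 `<=` @SES R n.+1.
Proof.
move=> f Jf y G oG [g Gg]; apply/card_eqPle; split.
  apply: card_le_trans (cardinality.card_leT _) _.
  exact: card_leT_trans (card_leT_rV_cantor R n.+1) (card_leT_cantor_real R).
(* [G] is replaced by a compact subset with continuum many points, whose copy at height [y] is
   closed. *)
have [|K [cK KG CK]] := perfect_rV_card (perfect_rV R n) oG; first by exists g.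
have := Jf (K `*` [set y]).
rewrite fst_setX_point => /(_ _ (uncountable_cantor_le CK)) RK.
apply: card_le_trans (RK _) _.
  by apply: closed_setX_point; apply: compact_closed cK; exact: norm_hausdorff.
by apply: subset_card_le => x [/KG[]].
Qed.

Lemma strong_Jones_spaceable : ptws_spaceable (@strong_Jones R n.+1) (set R).
Proof.
(* [I] is the domain of the trace indicators of subsets of [R]; it still has at most continuum many
   elements. *)
pose I := ((nat -> R) * (nat -> bool))%type.
have IC : card_leT I cantor_seq.
  apply: card_leT_pair_cantor; last exact: card_lexx.
  apply: card_leT_trans (card_leT_countable_cantor nat).
  exact: card_leT_fun (card_leT_real_cantor R).
have [s [i sP]] := @exists_jones_weights R n.+1 I (fun=> 0, fun=> false) IC.
pose W := weighted_pullbacks s i.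
have subW : GRing.submod_closed [in W] by exact: weighted_pullbacks_submod.
(* The coefficients are determined by the function: a nonzero [a] gives a function attaining the
   value 1, as its graph meets the closed set at height 1. *)
have a0 (a : I -> R) : (forall x, s x * a (i x) = 0) -> forall q, a q = 0.
  move=> sa q; apply: contrapT => /eqP aq.
  have := sP a (ex_intro _ q aq) (setT `*` [set 1]).
  rewrite fst_setX_point => /(_ (closed_setX_point (@closedT _))).
  case/(_ _)/card_setTP => [|x _ /(_ 0) [_ /= ]].
    by apply: uncountable_cantor_le; exact: card_leT_cantor_rV.
  by rewrite sa => /esym/eqP; rewrite oner_eq0.
pose g (A : set R) : X -> R := fun x => s x * trace_indicator R A (i x).
have ginj : injective g.
  move=> A B gAB; apply: (@trace_indicator_inj R); apply/funext => q; apply/eqP.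
  rewrite -subr_eq0; apply/eqP.
  apply: (a0 (fun q => trace_indicator R A q - trace_indicator R B q)) => x.
  by rewrite mulrBr; apply/eqP; rewrite subr_eq0; apply/eqP/(congr1 (@^~ x) gAB).
have indep : lin_indep (range g).
  move=> l c ul lg suml v lv.
  have /choice[A AE] : forall u, exists A, u \in l -> g A = u.
    move=> u; have [/lg[A _ gA]|] := boolP (u \in l); first by exists A.
    by exists set0.
  have [|q qv qu] := @trace_indicator_separates R R _ l A v.
    by move=> u ul' /eqP uv Auv; apply: uv; rewrite -(AE u ul') -(AE v lv) Auv.
  (* By [a0] the same combination of indicators vanishes everywhere, and at the separating [q] it
     reduces to [c v]. *)
  have := a0 (fun q => \sum_(u <- l) c u * trace_indicator R (A u) q) _ q.
  rewrite (bigD1_seq v)//= qv mulr1 big_seq_cond big1 ?addr0; last first.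
    by move=> u /andP[ul' uv]; rewrite (qu u ul' uv) mulr0.
  apply=> x; transitivity ((\sum_(u <- l) c u *: u) x); last by rewrite suml.
  rewrite fct_sumE mulr_sumr big_seq [in RHS]big_seq; apply: eq_bigr => u ul'.
  have -> : (c u *: u) x = c u * g (A u) x by rewrite (AE u ul').
  by rewrite mulrCA.
have gW : range g `<=` W by move=> _ [A _ <-]; exists (trace_indicator R A).
have [H basisH gH] := exists_hamel_basis subW gW indep.
exists W; split=> //.
- exact: weighted_pullbacks_closed.
(* The basis is a set of functions, hence of size at most |set R|, and it contains the injective
   family [g] indexed by [set R]. *)
- exists H => //; apply/card_eqPle; split.
    exact: card_le_trans (cardinality.card_leT _) (card_leT_rV_functions R n.+1).
  by apply/card_setTP; exists g => // A; apply: gH; exists A.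
- move=> _ [a ->]; have [aq|na] := pselect (exists q, a q != 0).
    by left=> F cF uF; exact: (sP a aq F cF uF).
  right; apply/funext => x /=; have [->|ax] := eqVneq (a (i x)) 0.
    by rewrite mulr0.
  by case: na; exists (i x).
Qed.

End Main.
Theorem proposition4p3 (R : realType) (n : nat) (n_ge1 : (1 <= n)%N) :
  ((exists K : Type, is_succ_card (set R) K) /\
   (forall K : Type,
      is_ptws_Lp (@Jones R n) K <-> is_succ_card (set R) K)) /\
  [/\ ptws_spaceable (@Jones R n) (set R),
      ptws_spaceable (@PES R n) (set R),
      ptws_spaceable (@SES R n) (set R)
    & ptws_spaceable (@ES R n) (set R)].
Proof.
case: n n_ge1 => // n _.
have sJ := strong_Jones_spaceable R n.
have J := sub_ptws_spaceable (@strong_Jones_sub_Jones R n.+1) sJ.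
have S := sub_ptws_spaceable (@strong_Jones_sub_SES R n) sJ.
split; last first.
  split=> //; first exact: sub_ptws_spaceable (@Jones_sub_PES R n.+1) J.
  exact: sub_ptws_spaceable (@SES_sub_ES R n.+1) S.
split; first exact: exists_succ_card.
(* Both minima are over the same cardinals: those at most |set R| are excluded by the subspace of
   dimension |set R|, and for larger ones the bound on dimensions applies. *)
have LpE L : (forall D, card_leT L D -> ~ ptws_spaceable (@Jones R n.+1) D) <->
    card_ltT (set R) L.
  split=> [H|/card_ltTE nL D LD /ptws_spaceable_card_le DR]; last first.
    by apply: nL; exact: card_leT_trans LD DR.
  by apply/card_ltTE => LR; exact: H LR J.
by move=> K; split=> -[/LpE PK minK]; split=> // L /LpE; exact: minK.
Qed.
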